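(* There is an online algorithm that is $9$-competitive for online minimum-cost metric perfect matching with i.i.d. arrivals on tree metrics; i.e., for every instance whose metric is a tree metric, $\mathbb{E}[\mathrm{ALG}]\le 9\,\mathbb{E}[\mathrm{OPT}]$.
   Context: A tree metric is the shortest-path metric on the vertex set of a finite tree with nonnegative edge lengths. Online minimum-cost metric perfect matching with (known) i.i.d. arrivals: an instance consists of a finite metric space $(X,d)$, $n$ servers located at points $s_1,\dots,s_n\in X$ (not necessarily distinct), and a known probability distribution $\mathcal{D}$ over $X$. Then $n$ requests arrive one at a time, each drawn independently from $\mathcal{D}$. Upon arrival, each request must immediately and irrevocably be matched to a currently unmatched server, incurring cost equal to the distance between the request and the server. $\mathrm{ALG}$ is the total cost incurred by the algorithm, $\mathrm{OPT}$ the cost of a minimum-cost perfect matching between the realized requests and the servers (offline). Expectations are over the requests and the algorithm's randomness; $\alpha$-competitive means $\mathbb{E}[\mathrm{ALG}]\le\alpha\,\mathbb{E}[\mathrm{OPT}]$ on every instance. *)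

(* Defs.v *)
(* Mathematical Components, with the real numbers of MathComp-Analysis. *)
From HB Require Import structures.
From mathcomp Require Import all_boot all_order all_algebra all_fingroup.
From mathcomp Require Import reals.

Set Implicit Arguments.
Unset Strict Implicit.
Unset Printing Implicit Defensive.

Import Order.TTheory GRing.Theory Num.Theory.
Local Open Scope ring_scope.

Section Distributions.
Variables (R : realType) (T : finType).

Definition is_distr (p : T -> R) : Prop :=
  (forall x, 0 <= p x) /\ \sum_x p x = 1.

End Distributions.

Section TreeMetrics.
Variables (R : realType) (X : finType).

Definition is_tree (e : rel X) : Prop :=
  [/\ symmetric e, irreflexive e, (forall x y, connect e x y)
    & (forall c : seq X, (2 < size c)%N -> ~ ucycle e c)].

(* The length of the walk x :: p when the pair (a, b) has length w a b. *)
Fixpoint walk_length (w : X -> X -> R) (x : X) (p : seq X) : R :=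
  if p is y :: p' then w x y + walk_length w y p' else 0.

Definition is_shortest_path_metric (e : rel X) (w d : X -> X -> R) : Prop :=
  forall x y,
    (exists p, [/\ path e x p, last x p = y & walk_length w x p = d x y]) /\
    (forall p, path e x p -> last x p = y -> d x y <= walk_length w x p).

Definition is_tree_metric (d : X -> X -> R) : Prop :=
  exists (e : rel X) (w : X -> X -> R),
    [/\ is_tree e, (forall x y, w x y = w y x),
        (forall x y, e x y -> 0 <= w x y)
      & is_shortest_path_metric e w d].

End TreeMetrics.

(* Distinct points may be at distance 0, since edges of a tree may have
   length 0.  Nonnegativity of dist follows from the three axioms. *)
Record instance (R : realType) := Instance {
  point : finType;
  dist : point -> point -> R;
  dist_refl : forall x, dist x x = 0;
  dist_sym : forall x y, dist x y = dist y x;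
  dist_triangle : forall x y z, dist x z <= dist x y + dist y z;
  nserv : nat;
  server : 'I_nserv -> point;
  law : point -> R;
  law_distr : is_distr law
}.

(* The past requests, oldest first, each with the index of the server it was
   matched to. *)
Definition history (R : realType) (I : instance R) : Type :=
  seq (point I * 'I_(nserv I)).

(* serve h x j is the conditional probability of matching the current request
   x to server j given the past h.  The algorithm sees its own past choices, so
   drawing each choice afresh loses no generality over a random seed drawn in
   advance.  Nothing is required once all servers are used. *)
Record policy (R : realType) (I : instance R) := Policy {
  serve : history I -> point I -> 'I_(nserv I) -> R;
  serve_distr : forall h x, (size h < nserv I)%N -> is_distr (serve h x);
  serve_unmatched : forall h x j, (size h < nserv I)%N ->
    j \in [seq a.2 | a <- h] -> serve h x j = 0
}.

(* An algorithm knows the whole instance in advance, including the law of the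
   requests, but not the realized requests. *)
Definition online_algorithm (R : realType) : Type :=
  forall I : instance R, policy I.

Section Costs.
Variables (R : realType) (I : instance R).
Local Notation n := (nserv I).
Local Notation X := (point I).

Definition history_before (r : {ffun 'I_n -> X}) (m : {ffun 'I_n -> 'I_n})
    (t : 'I_n) : history I :=
  [seq (r u, m u) | u : 'I_n <- enum 'I_n & (u < t)%N].

Definition request_prob (r : {ffun 'I_n -> X}) : R := \prod_t law (r t).

Definition match_prob (A : policy I) (r : {ffun 'I_n -> X})
    (m : {ffun 'I_n -> 'I_n}) : R :=
  \prod_t serve A (history_before r m t) (r t) (m t).

Definition match_cost (r : {ffun 'I_n -> X}) (m : 'I_n -> 'I_n) : R :=
  \sum_t dist (r t) (server (m t)).

Definition opt_cost (r : {ffun 'I_n -> X}) : R :=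
  match_cost r [arg min_(s < (1%g : {perm 'I_n})) match_cost r s]%O.

Definition expected_alg (A : policy I) : R :=
  \sum_r request_prob r * \sum_m match_prob A r m * match_cost r m.

Definition expected_opt : R := \sum_r request_prob r * opt_cost r.

End Costs.

Definition competitive_on (R : realType) (C : instance R -> Prop)
    (alpha : R) (alg : online_algorithm R) : Prop :=
  forall I : instance R, C I -> expected_alg (alg I) <= alpha * expected_opt I.

(* Main.v *)
(** Deleting an edge of the tree cuts the points in two, and the metric is the
    sum of the resulting cut metrics weighted by the edge lengths; accordingly a
    measure mu can be transported to nu at cost sum_e w_e |mu(A_e) - nu(A_e)|,
    where A_e is one side of e.  Whenever k servers are left, the algorithm
    couples the law of the request at that cost with the uniform law on the free
    servers, so that the free servers always form a uniformly random k-subset of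
    all servers.  Both ALG and OPT then split over the edges.  For an edge with
    m of the n servers and request probability q on one side, and p = m / n, OPT
    pays at least L(q) = E|Bin(n, q) - m|, while ALG pays at most
    sum_k E|q - x_k|, x_k being the proportion of red balls when k balls are
    left in an urn with n balls, m of them red, emptied without replacement.
    With sigma^2 = n p (1 - p), the variance of x_k is at most sigma^2 / (n k),
    so the latter is at most n|q - p| + 2 sigma; and 2 sigma <= 4 L(p) by the
    fourth moment method, n|q - p| <= L(q), L(p) <= L(q) + n|q - p|. *)

Require Import Defs.
From HB Require Import structures.
From mathcomp Require Import all_boot all_order all_algebra all_fingroup.
From mathcomp Require Import reals.
From mathcomp Require boolp.
From mathcomp Require Import ring lra zify.
Import Order.TTheory GRing.Theory Num.Theory.
Local Open Scope ring_scope.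

Set Implicit Arguments.
Unset Strict Implicit.

(** * Transport of finitely supported measures *)

Section Transport.
Variable R : realType.

Definition transportable {I J : finType} (mu : I -> R) (nu : J -> R)
    (c : I -> J -> R) (C : R) : Prop :=
  exists pi : I -> J -> R,
    [/\ forall i j, 0 <= pi i j, forall i, \sum_j pi i j = mu i,
        forall j, \sum_i pi i j = nu j & \sum_i \sum_j pi i j * c i j <= C].

Lemma transportable_sym (I J : finType) (mu : I -> R) (nu : J -> R) c C :
  transportable mu nu c C -> transportable nu mu (fun j i => c i j) C.
Proof.
case=> pi [pi0 pi1 pi2 piC]; exists (fun j i => pi i j); split=> //.
by rewrite exchange_big.
Qed.

Lemma transportable_add (I J : finType) (mu mu' : I -> R) (nu nu' : J -> R) c C C' :
  transportable mu nu c C -> transportable mu' nu' c C' ->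
  transportable (fun i => mu i + mu' i) (fun j => nu j + nu' j) c (C + C').
Proof.
case=> pi [pi0 pi1 pi2 piC] [pi' [pi0' pi1' pi2' piC']].
exists (fun i j => pi i j + pi' i j); split=> [i j|i|j|].
- exact: addr_ge0.
- by rewrite big_split /= pi1 pi1'.
- by rewrite big_split /= pi2 pi2'.
apply: le_trans (lerD piC piC'); rewrite -big_split /= ler_sum // => i _.
by rewrite -big_split /= ler_sum // => j _; rewrite mulrDl.
Qed.

(** The plans are glued along the middle space: given its point [j], the two ends are taken
    independent, which gives the joint mass [p i j * q j k / nu j]. Where [nu j] is 0 both plans
    vanish, so the division by 0 is harmless. *)
Lemma transportable_trans (I J K : finType) (mu : I -> R) (nu : J -> R) (rho : K -> R)
    c1 c2 c3 C1 C2 :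
  transportable mu nu c1 C1 -> transportable nu rho c2 C2 ->
  (forall i j k, c3 i k <= c1 i j + c2 j k) ->
  transportable mu rho c3 (C1 + C2).
Proof.
move=> [p [p0 p1 p2 pC]] [q [q0 q1 q2 qC]] c_tri.
have nu0 j : 0 <= nu j by rewrite -q1 sumr_ge0.
have pnu i j : nu j = 0 -> p i j = 0.
  move=> h; have := p2 j; rewrite h => /eqP.
  by rewrite psumr_eq0 // => /allP /(_ i (mem_index_enum _)) /eqP.
have qnu j k : nu j = 0 -> q j k = 0.
  move=> h; have := q1 j; rewrite h => /eqP.
  by rewrite psumr_eq0 // => /allP /(_ k (mem_index_enum _)) /eqP.
have pK i j : p i j * (nu j / nu j) = p i j.
  by have [/pnu ->|h] := eqVneq (nu j) 0; rewrite ?mul0r // divff ?mulr1.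
have qK j k : (nu j / nu j) * q j k = q j k.
  by have [/qnu ->|h] := eqVneq (nu j) 0; rewrite ?mulr0 // divff ?mul1r.
pose g i j k := p i j / nu j * q j k.
have gk i j : \sum_k g i j k = p i j by rewrite -mulr_sumr q1 mulrAC -mulrA pK.
have gi j k : \sum_i g i j k = q j k by rewrite -!mulr_suml p2 qK.
exists (fun i k => \sum_j g i j k); split=> [i k|i|k|].
- by apply: sumr_ge0 => j _; rewrite !mulr_ge0 ?invr_ge0.
- by rewrite exchange_big -p1; apply: eq_bigr => j _; rewrite gk.
- by rewrite exchange_big -q2; apply: eq_bigr => j _; rewrite gi.
have -> : \sum_i \sum_k (\sum_j g i j k) * c3 i k =
          \sum_i \sum_j \sum_k g i j k * c3 i k.
  apply: eq_bigr => i _; rewrite exchange_big; apply: eq_bigr => k _.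
  by rewrite mulr_suml.
apply: le_trans (lerD pC qC).
have -> : \sum_i \sum_j p i j * c1 i j = \sum_i \sum_j \sum_k g i j k * c1 i j.
  apply: eq_bigr => i _; apply: eq_bigr => j _.
  by rewrite -mulr_suml gk.
have -> : \sum_j \sum_k q j k * c2 j k = \sum_i \sum_j \sum_k g i j k * c2 j k.
  rewrite [RHS]exchange_big; apply: eq_bigr => j _.
  rewrite [RHS]exchange_big; apply: eq_bigr => k _.
  by rewrite -mulr_suml gi.
rewrite -big_split /= ler_sum // => i _; rewrite -big_split /= ler_sum // => j _.
rewrite -big_split /= ler_sum // => k _; rewrite -mulrDr ler_wpM2l //.
by rewrite !mulr_ge0 ?invr_ge0.
Qed.

(** The mass at [i] is split over the fibre of [f] above [i]. This is how mass at a point of the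
    space is handed to the servers located there. *)
Lemma transportable_preimage (I J : finType) (f : J -> I) (nu : J -> R) c :
  (forall j, 0 <= nu j) -> (forall j, c (f j) j = 0) ->
  transportable (fun i => \sum_(j | f j == i) nu j) nu c 0.
Proof.
move=> nu0 cf; exists (fun i j => if f j == i then nu j else 0); split.
- by move=> i j; case: ifP.
- by move=> i; rewrite -big_mkcond.
- by move=> j; rewrite -big_mkcond /= (big_pred1 (f j)) // => i; rewrite eq_sym.
rewrite big1 // => i _; rewrite big1 // => j _.
by case: eqP => [<-|]; rewrite ?cf ?mulr0 ?mul0r.
Qed.

Lemma transportable_ext (I J : finType) (mu mu' : I -> R) (nu nu' : J -> R) c C C' :
  mu =1 mu' -> nu =1 nu' -> C <= C' ->
  transportable mu nu c C -> transportable mu' nu' c C'.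
Proof.
move=> e1 e2 CC [p [p0 p1 p2 pC]]; exists p; split=> // [i|j|].
- by rewrite p1.
- by rewrite p2.
exact: le_trans CC.
Qed.

Lemma transportable_refl (I : finType) (mu : I -> R) c :
  (forall i, 0 <= mu i) -> (forall i, c i i = 0) -> transportable mu mu c 0.
Proof.
move=> mu0 cii; apply: (transportable_ext _ _ _ (transportable_preimage (f := id) mu0 cii)) => // i.
by rewrite big_pred1_eq.
Qed.

Definition dirac {I : finType} (i : I) (a : R) (x : I) : R := if x == i then a else 0.

Lemma sum_dirac (I : finType) (P : pred I) (i : I) a :
  \sum_(x | P x) dirac i a x = if P i then a else 0.
Proof.
rewrite /dirac -big_mkcondr /=; case: ifP => Pi.
  by rewrite (big_pred1 i) // => x /=; case: eqP => [->|_]; rewrite ?Pi ?andbF.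
by rewrite big_pred0 // => x; apply/negP => /andP[Px /eqP xi]; rewrite -xi Px in Pi.
Qed.

Lemma transportable_dirac (I J : finType) (i : I) (j : J) a c :
  0 <= a -> transportable (dirac i a) (dirac j a) c (a * c i j).
Proof.
move=> a0; exists (fun x y => if x == i then dirac j a y else 0); split.
- by move=> x y; rewrite /dirac; case: (x == i); case: (y == j).
- move=> x; rewrite {2}/dirac; case: ifP => _; last by rewrite big1.
  by rewrite sum_dirac.
- by move=> y; rewrite -big_mkcond big_pred1_eq.
rewrite (bigD1 i) //= [X in _ + X]big1 ?addr0; last first.
  by move=> x /negPf ->; rewrite big1 // => y _; rewrite mul0r.
rewrite eqxx (bigD1 j) //= big1 ?addr0 /dirac ?eqxx //.
by move=> y /negPf ->; rewrite mul0r.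
Qed.

End Transport.

(** * Tree metrics as sums of cut metrics *)

Section Trees.
Variables (R : realType) (X : finType) (d : X -> X -> R).

Definition del_edge (e : rel X) (u v : X) : rel X :=
  [rel a b | [&& e a b, (a, b) != (u, v) & (a, b) != (v, u)]].

(** A walk from [u] to [v] avoiding the edge, shortened to a simple path, has at least two edges;
    the edge then closes it into a cycle of length at least 3. *)
Lemma tree_bridge (e : rel X) u v : is_tree e -> e u v -> ~~ connect (del_edge e u v) u v.
Proof.
case=> e_sym e_irr _ acyc euv; apply/negP => /connectP [p0 ep0 vE].
have uv : u != v by apply: contraTneq euv => ->; rewrite e_irr.
case: (shortenP ep0) vE => p ep uniq_p _ vE.
have ep' : path e u p by apply: sub_path ep => a b /andP[].
case: p ep ep' uniq_p vE => [|x [|y p]] /= ep ep' uniq_p vE.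
- by rewrite vE eqxx in uv.
- by move: ep; rewrite -vE /del_edge /= eqxx !andbF.
apply: (acyc (u :: x :: y :: p)) => //; apply/andP; split=> //=.
by move: ep'; rewrite rcons_path /= -vE (e_sym v) euv => /and3P[-> -> ->].
Qed.

Lemma path_exit (e : rel X) (C : {pred X}) x p : path e x p -> x \notin C -> last x p \in C ->
  exists a b p1 p2, [/\ p = p1 ++ b :: p2, last x p1 = a, e a b, a \notin C & b \in C].
Proof.
elim: p x => [|y p IHp] x /=; first by move=> _ /negP.
move=> /andP[exy ep] xC lC; have [yC|yC] := boolP (y \in C).
  by exists x, y, [::], p; split.
have [a [b [p1 [p2 [-> la eab aC bC]]]]] := IHp y ep yC lC.
by exists a, b, (y :: p1), p2; split.
Qed.

Lemma walk_length_cat w x (p1 p2 : seq X) :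
  @walk_length R X w x (p1 ++ p2) = walk_length w x p1 + walk_length w (last x p1) p2.
Proof. by elim: p1 x => [|y p IHp] x /=; rewrite ?add0r // IHp addrA. Qed.

Lemma walk_length_ge0 (e : rel X) (w : X -> X -> R) x p :
  (forall a b, e a b -> 0 <= w a b) -> path e x p -> 0 <= walk_length w x p.
Proof.
move=> w0; elim: p x => [|y p IHp] x //= /andP[exy ep].
by rewrite addr_ge0 ?w0 ?IHp.
Qed.

Definition connected_in (e : rel X) (V : {set X}) :=
  forall x y, x \in V -> y \in V ->
    connect [rel a b | [&& e a b, a \in V & b \in V]] x y.

(** All of [V] lies on the side of [u] of the bridge between [u] and [v], so a walk from [v] into
    [V] must cross from [v] to [u]. *)
Lemma tree_leaf_dist (e : rel X) (w : X -> X -> R) (V : {set X}) u v :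
  (forall x, d x x = 0) ->
  is_tree e -> (forall x y, w x y = w y x) -> (forall x y, e x y -> 0 <= w x y) ->
  is_shortest_path_metric e w d -> connected_in e V ->
  u \in V -> v \notin V -> e u v ->
  forall x, x \in V -> d v x = d v u + d u x.
Proof.
move=> d0 tr w_sym w0 dw Vc uV vV euv; have [e_sym _ _ _] := tr.
pose C := connect (del_edge e u v) u.
have VC x : x \in V -> x \in C.
  move=> xV; apply: connect_sub (Vc u x uV xV) => a b /and3P[eab aV bV].
  apply: connect1; rewrite /del_edge /= eab /=; apply/andP; split.
    by apply/eqP => -[_ bv]; rewrite -bv bV in vV.
  by apply/eqP => -[av _]; rewrite -av aV in vV.
have vC : v \notin C by apply: tree_bridge.
have dvx x : x \in V -> d v x = w v u + d u x.
  move=> xV; apply/eqP; rewrite eq_le; apply/andP; split.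
    have [[p [ep px <-]] _] := dw u x; have [_ le_d] := dw v x.
    by apply: (le_d (u :: p)) => //=; rewrite e_sym euv.
  have [[p [ep px <-]] _] := dw v x.
  have lC : last v p \in C by rewrite px VC.
  have [a [b [p1 [p2 [pE la eab aC bC]]]]] := path_exit ep vC lC.
  have [av bu] : a = v /\ b = u.
    apply/pair_equal_spec; have: ~~ del_edge e u v b a.
      apply: contra aC => ba; apply: connect_trans bC (connect1 ba).
    rewrite /del_edge /= (e_sym b) eab /= negb_and !negbK => /orP[] /eqP [bE aE].
      by rewrite bE aE.
    by case/negP: vC; rewrite -bE.
  move: ep px; rewrite pE bu; rewrite av in la.
  rewrite cat_path last_cat walk_length_cat la /= => /and3P[ep1 _ ep2] px.
  rewrite -[leLHS]add0r; apply: lerD; first exact: walk_length_ge0 ep1.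
  by rewrite lerD2l; have [_] := dw u x; apply.
by move=> x xV; rewrite dvx // (dvx u) // d0 addr0.
Qed.

(** A connected set of vertices is grown by one neighbour at a time. By [tree_leaf_dist], the new
    vertex hangs as a leaf from the set built so far. *)
Lemma tree_metric_ind (P : {set X} -> Prop) :
  (forall x, d x x = 0) -> is_tree_metric d ->
  (forall r, P [set r]) ->
  (forall (V : {set X}) u v, u \in V -> v \notin V ->
     (forall x, x \in V -> d v x = d v u + d u x) -> P V -> P (v |: V)) ->
  forall r : X, P setT.
Proof.
move=> d0 [e [w [tr w_sym w0 dw]]] P1 PS r; have [e_sym _ e_conn _] := tr.
suff: forall k (V : {set X}), #|~: V| = k -> r \in V -> connected_in e V -> P V -> P setT.
  move/(_ _ [set r] erefl); rewrite set11; apply=> //.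
  by move=> x y /set1P -> /set1P ->.
elim=> [|k IHk] V kV rV Vc PV.
  move/cards0_eq: kV => /(congr1 (@setC X)); rewrite setCK setC0 => VT.
  by rewrite -VT.
have [y yV] : exists y, y \notin V.
  have /card_gt0P [y] : (0 < #|~: V|)%N by rewrite kV.
  by rewrite inE; exists y.
have /connectP[p ep yE] := e_conn r y.
have rV' : r \notin ~: V by rewrite inE negbK.
have [|u [v [_ [_ [_ _ euv uV vV]]]]] := path_exit (C := mem (~: V)) ep rV'.
  by rewrite -yE inE.
rewrite inE negbK in uV; rewrite inE in vV.
apply: (IHk (v |: V)).
- apply/eqP; rewrite -eqSS -kV; apply/eqP.
  rewrite (cardsD1 v (~: V)) inE vV add1n; congr (_.+1); apply: eq_card => x.
  by rewrite !inE negb_or.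
- by rewrite !inE rV orbT.
- have Vc' x z : x \in V -> z \in V ->
      connect [rel a b | [&& e a b, a \in v |: V & b \in v |: V]] x z.
    move=> xV zV; apply: connect_sub (Vc x z xV zV) => a b /and3P[eab aV bV].
    by apply: connect1; rewrite /= !inE eab aV bV !orbT.
  have vu : connect [rel a b | [&& e a b, a \in v |: V & b \in v |: V]] v u.
    by apply: connect1; rewrite /= e_sym euv !inE eqxx uV orbT.
  have uv : connect [rel a b | [&& e a b, a \in v |: V & b \in v |: V]] u v.
    by apply: connect1; rewrite /= euv !inE eqxx uV orbT.
  move=> x z /setU1P[->|xV] /setU1P[->|zV] //; last exact: Vc'.
  + exact: connect_trans vu (Vc' _ _ uV zV).
  + exact: connect_trans (Vc' _ _ xV uV) uv.
apply: (PS V u v) => // x xV; exact: (@tree_leaf_dist e w V u v).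
Qed.

End Trees.

(** * Cut decompositions, built leaf by leaf *)

Section CutMetric.
Variables (R : realType) (X : finType) (d : X -> X -> R).

(* [cuts] lists the length of each edge of the tree together with one of the two
   sides into which the edge cuts the points. *)
Definition cut_sum (cuts : seq (R * {set X})) (f : {set X} -> R) : R :=
  \sum_(c <- cuts) c.1 * f c.2.

Lemma cut_sumZ a cuts f : a * cut_sum cuts f = cut_sum cuts (fun A => a * f A).
Proof. by rewrite /cut_sum mulr_sumr; apply: eq_bigr => c _; rewrite mulrCA. Qed.

(** The second clause serves the lower bound on OPT, the third the upper bound on ALG; each asks
    only for the inequality used there. *)
Definition cut_decomposition (V : {set X}) (cuts : seq (R * {set X})) : Prop :=
  [/\ forall c, c \in cuts -> 0 <= c.1,
      forall x y, x \in V -> y \in V ->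
        cut_sum cuts (fun A : {set X} => `|(x \in A)%:R - (y \in A)%:R|) <= d x y
    & forall mu nu : X -> R,
        (forall x, 0 <= mu x) -> (forall x, 0 <= nu x) ->
        (forall x, x \notin V -> mu x = 0) -> (forall x, x \notin V -> nu x = 0) ->
        \sum_x mu x = \sum_x nu x ->
        transportable mu nu d
          (cut_sum cuts (fun A : {set X} => `|\sum_(x in A) mu x - \sum_(x in A) nu x|))].

Hypotheses (d_refl : forall x, d x x = 0) (d_sym : forall x y, d x y = d y x)
  (d_tri : forall x y z, d x z <= d x y + d y z).

Lemma d_ge0 x y : 0 <= d x y.
Proof. by have := d_tri x y x; rewrite d_refl (d_sym y); lra. Qed.

Lemma cut_decomposition1 r : cut_decomposition [set r] [::].
Proof.
split=> // [x y /set1P-> /set1P->|mu nu mu0 nu0 muV nuV mu_nu].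
  by rewrite /cut_sum big_nil d_refl.
rewrite /cut_sum big_nil.
apply: (transportable_ext _ _ _ (transportable_refl mu0 d_refl)).
- by [].
- move=> x; have [->|xr] := eqVneq x r; last by rewrite muV ?nuV // inE.
  move: mu_nu; rewrite (bigD1 r) //= [RHS](bigD1 r) //= !big1 ?addr0 // => i ir.
    by rewrite nuV // inE.
  by rewrite muV // inE.
- by [].
Qed.

(** The vertex [v] hangs as a leaf from [u]. The old cuts are pulled back along the contraction of
    the new edge, which sends [v] to [u]. *)
Definition extend_cuts (u v : X) (cuts : seq (R * {set X})) : seq (R * {set X}) :=
  (d v u, [set v]) ::
  [seq (c.1, [set x | (if x == v then u else x) \in c.2]) | c : R * {set X} <- cuts].

Lemma cut_sum_extend u v cuts (f : {set X} -> R) :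
  cut_sum (extend_cuts u v cuts) f = d v u * f [set v] +
  cut_sum cuts (fun A : {set X} => f [set x | (if x == v then u else x) \in A]).
Proof. by rewrite /cut_sum big_cons big_map. Qed.

(** The excess of mass at [v] can only leave through the new edge. It is moved to [u]; afterwards
    the two measures agree at [v], and a balanced problem inside [V] remains. *)
Lemma cut_decomposition_leaf (V : {set X}) u v cuts : u \in V -> v \notin V ->
  (forall x, x \in V -> d v x = d v u + d u x) ->
  cut_decomposition V cuts -> cut_decomposition (v |: V) (extend_cuts u v cuts).
Proof.
move=> uV vV leaf [w0 cut_le transp].
have neq_v x : x \in V -> (x == v) = false.
  by move=> xV; apply: contraNF vV => /eqP <-.
split=> [c|x y|mu nu mu0 nu0 muV nuV mu_nu].
- rewrite inE => /predU1P[->|/mapP[c' c'c ->]] /=; [exact: d_ge0 | exact: w0].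
- have leaf_le z : z \in V ->
      cut_sum (extend_cuts u v cuts) (fun A : {set X} => `|(v \in A)%:R - (z \in A)%:R|) <= d v z.
    move=> zV; rewrite cut_sum_extend (leaf z) // !inE eqxx neq_v // subr0 normr1 mulr1.
    rewrite lerD2l; apply: le_trans (cut_le u z uV zV).
    rewrite le_eqVlt; apply/orP; left; apply/eqP.
    by apply: eq_bigr => c _; rewrite !inE eqxx neq_v.
  move=> /setU1P[->|xV] /setU1P[->|yV]; last 1 first.
  + rewrite cut_sum_extend !inE !neq_v // subrr normr0 mulr0 add0r.
    apply: le_trans (cut_le x y xV yV).
    rewrite le_eqVlt; apply/orP; left; apply/eqP.
    by apply: eq_bigr => c _; rewrite !inE !neq_v.
  + by rewrite d_refl /cut_sum big1 // => c _; rewrite subrr normr0 mulr0.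
  + exact: leaf_le.
  + rewrite d_sym; apply: le_trans (leaf_le x xV).
    by rewrite le_eqVlt; apply/orP; left; apply/eqP; apply: eq_bigr => c _; rewrite distrC.
wlog le_nu : mu nu mu0 nu0 muV nuV mu_nu / nu v <= mu v.
  move=> H; have [le|/ltW le] := leP (nu v) (mu v); first exact: H.
  have := H nu mu nu0 mu0 nuV muV (esym mu_nu) le.
  move/transportable_sym; case=> p [p0 p1 p2 pC]; exists p; split=> //.
  under eq_bigr do under eq_bigr do rewrite d_sym.
  apply: le_trans pC _; rewrite le_eqVlt; apply/orP; left; apply/eqP.
  by apply: eq_bigr => c _; rewrite distrC.
pose mu1 x := if x == v then 0 else mu x.
pose nu1 x := if x == v then 0 else nu x.
pose a := mu v - nu v.
have a0 : 0 <= a by rewrite subr_ge0.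
have mu1_0 x : 0 <= mu1 x by rewrite /mu1; case: ifP.
have nu1_0 x : 0 <= nu1 x by rewrite /nu1; case: ifP.
have mu_split (f : X -> R) (P : pred X) :
   \sum_(x | P x) f x = (if P v then f v else 0) + \sum_(x | P x) (if x == v then 0 else f x).
  rewrite -(sum_dirac P v) -big_split /=; apply: eq_bigr => x _.
  by rewrite /dirac; case: eqP => [->|]; rewrite ?addr0 ?add0r.
have diracV x : x \notin V -> dirac u a x = 0.
  by move=> xV; rewrite /dirac; case: eqP => // xu; rewrite xu uV in xV.
have T1 : transportable mu (fun x => mu1 x + dirac v (nu v) x + dirac u a x) d
    (a * d v u).
  apply: (transportable_ext _ _ _
    (transportable_add
      (transportable_refl (mu := fun x => mu1 x + dirac v (nu v) x) _ d_refl)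
      (transportable_dirac v u d a0))) => //.
  - move=> x; rewrite /mu1 /dirac; case: eqP => [->|_]; last by rewrite !addr0.
    by rewrite /a add0r addrCA subrr addr0.
  - by rewrite add0r.
  - by move=> x; rewrite addr_ge0 // /dirac; case: ifP.
pose C2 := cut_sum cuts (fun A : {set X} =>
  `|\sum_(x in A) (mu1 x + dirac u a x) - \sum_(x in A) nu1 x|).
have T2 : transportable (fun x => mu1 x + dirac u a x) nu1 d C2.
  apply: transp => //.
  - by move=> x; rewrite addr_ge0 // /dirac; case: ifP.
  - move=> x xV; rewrite diracV // addr0 /mu1; case: eqP => // /eqP xv.
    by rewrite muV // !inE negb_or xv.
  - move=> x xV; rewrite /nu1; case: eqP => // /eqP xv.
    by rewrite nuV // !inE negb_or xv.
  - rewrite big_split /= sum_dirac; move: mu_nu; rewrite mu_split [RHS]mu_split /= -/mu1 -/nu1.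
    rewrite /a; lra.
have T3 := transportable_add T2
   (transportable_refl (mu := dirac v (nu v))
      (fun x => ltac:(by rewrite /dirac; case: ifP)) d_refl).
have T3' : transportable (fun x => mu1 x + dirac v (nu v) x + dirac u a x) nu d C2.
  apply: (transportable_ext _ _ _ T3) => //.
  - by move=> x; rewrite addrAC.
  - by move=> x; rewrite /nu1 /dirac; case: eqP => [->|_]; rewrite ?add0r ?addr0.
  - by rewrite addr0.
have := transportable_trans T1 T3' d_tri.
apply: transportable_ext => //; rewrite cut_sum_extend.
rewrite le_eqVlt; apply/orP; left; apply/eqP; congr (_ + _).
  by rewrite !big_set1 mulrC ger0_norm.
(* Moving the excess from [v] to [u] does not change the imbalance across a pulled-back cut, which
   has both points on the same side. *)
apply: eq_bigr => c _; congr (_ * `|_|).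
rewrite big_split /= sum_dirac.
rewrite [in RHS]mu_split [X in _ = _ - X]mu_split !inE eqxx.
have E (f : X -> R) : \sum_(x in [set x | (if x == v then u else x) \in c.2])
    (if x == v then 0 else f x) = \sum_(x in c.2) (if x == v then 0 else f x).
  rewrite [LHS]big_mkcond [RHS]big_mkcond /=; apply: eq_bigr => x _; rewrite inE.
  by case: eqP => // _; rewrite !if_same.
rewrite !E /a; case: ifP => _; rewrite /mu1 /nu1; lra.
Qed.

Lemma tree_cut_decomposition (r : X) : is_tree_metric d ->
  exists cuts, cut_decomposition setT cuts.
Proof.
move=> tr; apply: (@tree_metric_ind _ _ d (fun V => exists cuts, cut_decomposition V cuts)) => //.
- by move=> x; exists [::]; apply: cut_decomposition1.
- move=> V u v uV vV leaf [cuts Vcuts]; exists (extend_cuts u v cuts).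
  exact: cut_decomposition_leaf.
Qed.

End CutMetric.

(** * Absolute deviation of the binomial law *)

Section BinomialExpectation.
Variable R : realType.
Implicit Types (f : R -> R) (p q y z : R).

(* The expectation of [f (y + B)], with [B] binomial of parameters [n] and [q]. *)
Fixpoint binomE q f n y : R :=
  if n is n'.+1 then q * binomE q f n' (y + 1) + (1 - q) * binomE q f n' y else f y.

Lemma binomE_le q f g n y : 0 <= q <= 1 -> (forall x, f x <= g x) ->
  binomE q f n y <= binomE q g n y.
Proof.
move=> /andP[q0 q1] fg; elim: n y => [|n IHn] y //=.
by apply: lerD; apply: ler_wpM2l; rewrite ?subr_ge0.
Qed.

Lemma binomE_linear q b c n y :
  binomE q (fun x => b * x + c) n y = b * (y + n%:R * q) + c.
Proof. by elim: n y => [|n IHn] y /=; rewrite ?IHn -?natr1; ring. Qed.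

(** A general [y] lets the induction go through; at [z = 0] the second and fourth central moments
    are read off. *)
Lemma binomE_quartic p b c n y : let v := p * (1 - p) in let z := y + n%:R * p in
  binomE p (fun x => b * x ^+ 2 + c * x ^+ 4) n y =
  b * (z ^+ 2 + n%:R * v) +
  c * (z ^+ 4 + 6 * z ^+ 2 * n%:R * v + 4 * z * n%:R * v * (1 - 2 * p)
       + 3 * n%:R * (n%:R - 1) * v ^+ 2 + n%:R * v * (1 - 3 * v)).
Proof.
by move=> v z; rewrite {}/v {}/z; elim: n y => [|n IHn] y /=; rewrite ?IHn -?natr1; ring.
Qed.

(** Jensen's inequality, from the two linear minorants of the absolute value. *)
Lemma binomE_norm_ge q n y : 0 <= q <= 1 -> `|y + n%:R * q| <= binomE q Num.norm n y.
Proof.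
move=> q01; rewrite ler_norml; apply/andP; split.
  have := binomE_le (f := fun x => -1 * x + 0) (g := Num.norm) n y q01.
  rewrite binomE_linear addr0 mulN1r lerNl => -> //= x.
  by rewrite addr0 mulN1r lerNl lerNnormlW.
have := binomE_le (f := fun x => 1 * x + 0) (g := Num.norm) n y q01.
by rewrite binomE_linear addr0 mul1r; apply=> x; rewrite addr0 mul1r ler_norm.
Qed.

Lemma binomE_norm_shift q n y : 0 <= q <= 1 ->
  `|binomE q Num.norm n (y + 1) - binomE q Num.norm n y| <= 1.
Proof.
move=> /andP[q0 q1]; elim: n y => [|n IHn] y /=.
  by apply: le_trans (ler_dist_dist _ _) _; rewrite addrAC subrr add0r normr1.
have := IHn y; have := IHn (y + 1); rewrite !ler_norml => /andP[a b] /andP[c d].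
by apply/andP; split; nra.
Qed.

(** The parameters are exchanged one trial at a time. Each exchange costs at most [|p - q|], since
    one more success shifts the expectation by at most 1. *)
Lemma binomE_norm_coupling p q n y : 0 <= p <= 1 -> 0 <= q <= 1 ->
  binomE p Num.norm n y <= binomE q Num.norm n y + n%:R * `|p - q|.
Proof.
move=> p01 q01; have /andP[q0 q1] := q01; elim: n y => [|n IHn] y /=; first lra.
have := IHn (y + 1); have := IHn y; have := binomE_norm_shift n y p01.
rewrite -natr1.
move: (binomE p _ n (y + 1)) (binomE p _ n y) (binomE q _ n (y + 1)) (binomE q _ n y).
move=> a b c d ab bd ac.
have h : (p - q) * (a - b) <= `|p - q|.
  apply: le_trans (ler_norm _) _; rewrite normrM -[leRHS]mulr1.
  exact: ler_wpM2l.
have h1 : 0 <= q * (c + n%:R * `|p - q| - a) by rewrite mulr_ge0 // subr_ge0.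
have h2 : 0 <= (1 - q) * (d + n%:R * `|p - q| - b) by rewrite mulr_ge0 // subr_ge0.
lra.
Qed.

(** The quartic touches the absolute value at [t]: as a polynomial in [|x|], the difference has a
    double root there and factors into nonnegative terms. *)
Lemma norm_ge_quartic (t x : R) : 0 < t ->
  3 / (2 * t) * x ^+ 2 + (- (2 * t ^+ 3)^-1) * x ^+ 4 <= `|x|.
Proof.
move=> t0; rewrite -[x ^+ 2]real_normK ?num_real //.
have -> : x ^+ 4 = `|x| ^+ 4.
  by rewrite -[4%N]/(2 * 2)%N !exprM real_normK ?num_real.
have := normr_ge0 x; move: `|x| => {}x x0; rewrite -subr_ge0.
have -> : x - (3 / (2 * t) * x ^+ 2 + (- (2 * t ^+ 3)^-1) * x ^+ 4) =
   x * (x - t) ^+ 2 * (x + 2 * t) / (2 * t ^+ 3).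
  by field; rewrite gt_eqF.
apply: divr_ge0; last by rewrite mulr_ge0 // exprn_ge0 // ltW.
by apply: mulr_ge0; [rewrite mulr_ge0 ?sqr_ge0 | lra].
Qed.

(* Fourth moment method: [norm_ge_quartic] is applied with [t] twice the standard
   deviation [s], and the fourth central moment is at most [4 s^4]. *)
Lemma binomE_norm_ge_sd (n m : nat) p : (0 < m < n)%N -> n%:R * p = m%:R ->
  Num.sqrt (n%:R * (p * (1 - p))) / 2 <= binomE p Num.norm n (- m%:R).
Proof.
move=> /andP[m0 mn] np.
have n0 : 0 < n%:R :> R by rewrite ltr0n; lia.
have m1 : 1 <= m%:R :> R by rewrite ler1n.
have mn1 : m%:R + 1 <= n%:R :> R by rewrite natr1 ler_nat.
have pE : p = m%:R / n%:R by rewrite -np; field; rewrite gt_eqF.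
have p01 : 0 <= p <= 1.
  by apply/andP; split; rewrite pE ?divr_ge0 ?ler0n // ler_pdivrMr //; lra.
set v := p * (1 - p); set s := Num.sqrt _.
have nv : n%:R * v = m%:R * (n%:R - m%:R) / n%:R.
  by rewrite /v pE; field; rewrite gt_eqF.
have v0 : 0 < n%:R * v by rewrite nv divr_gt0 // mulr_gt0 //; lra.
have s0 : 0 < s by rewrite sqrtr_gt0.
have s2 : n%:R * v = s ^+ 2 by rewrite sqr_sqrtr // ltW.
have t0 : 0 < 2 * s by rewrite mulr_gt0.
have := binomE_le n (- m%:R) p01 (fun x => norm_ge_quartic x t0).
apply: le_trans; rewrite binomE_quartic /= np addNr -/v.
have key : 3 * n%:R * (n%:R - 1) * v ^+ 2 + n%:R * v * (1 - 3 * v) <= 4 * s ^+ 4.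
  have -> : s ^+ 4 = (n%:R * v) ^+ 2 by rewrite s2 -exprM.
  rewrite -subr_ge0.
  have -> : 4 * (n%:R * v) ^+ 2 -
     (3 * n%:R * (n%:R - 1) * v ^+ 2 + n%:R * v * (1 - 3 * v)) =
     (n%:R * v) * ((n%:R * v) * (n%:R + 6) - n%:R) / n%:R.
    by field; rewrite gt_eqF.
  apply: divr_ge0; last exact: ltW.
  apply: mulr_ge0; first exact: ltW.
  rewrite subr_ge0 nv mulrAC ler_pdivlMr //.
  (* As [m] lies between 1 and [n - 1], [m (n - m)] is at least [n - 1]; and [(n - 1) (n + 6)] is at
     least [n ^ 2] because [n] is at least 2. *)
  have h : 0 <= (m%:R - 1) * (n%:R - m%:R - 1) :> R by rewrite mulr_ge0 //; lra.
  have : (n%:R - 1) * (n%:R + 6) <= m%:R * (n%:R - m%:R) * (n%:R + 6) :> R.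
    by apply: ler_wpM2r; lra.
  lra.
rewrite !expr0n /= !(mulr0, mul0r, add0r, addr0) s2.
have -> : s / 2 = 3 / (2 * (2 * s)) * s ^+ 2 - (2 * (2 * s) ^+ 3)^-1 * (4 * s ^+ 4).
  by field; rewrite gt_eqF.
rewrite mulNr lerD2l lerN2; apply: ler_wpM2l.
  by rewrite invr_ge0 mulr_ge0 // exprn_ge0 // ltW.
by apply: le_trans key; rewrite -s2.
Qed.

End BinomialExpectation.

(** * Sampling without replacement *)

Section UrnPotential.
Variable R : realType.
Implicit Types (p q x v : R) (c e : nat -> R).

(* The expectation of [(x_j - p)^2], [x_j] being the proportion of red balls when
   [j] balls are left, given that this proportion is [x] when [k] balls are
   left.  For [k = j = 1] the fraction is [0 / 0 = 0], as it should be. *)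
Definition urn_sq_dev p (k j : nat) x : R :=
  (x - p) ^+ 2 + x * (1 - x) * (k%:R - j%:R) / ((k%:R - 1) * j%:R).

(** The tower rule for the draw of one ball out of [k + 1], [a] of them red. *)
Lemma urn_sq_dev_step p (k j a : nat) : (0 < j <= k)%N ->
  a%:R / k.+1%:R * urn_sq_dev p k j ((a%:R - 1) / k%:R) +
  (1 - a%:R / k.+1%:R) * urn_sq_dev p k j (a%:R / k%:R) =
  urn_sq_dev p k.+1 j (a%:R / k.+1%:R).
Proof.
move=> /andP[j0 jk]; have j1 : j%:R != 0 :> R by rewrite pnatr_eq0; lia.
have k1 : k.+1%:R != 0 :> R by rewrite pnatr_eq0.
have [k2|k2] := leqP k 1.
  have -> : k = 1%N by lia.
  have -> : j = 1%N by lia.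
  rewrite /urn_sq_dev !subrr !mulr0 !mul0r !addr0 (_ : 2%:R - 1 = 1); last by ring. by field.
have k0 : k%:R != 0 :> R by rewrite pnatr_eq0; lia.
have km : k%:R - 1 != 0 :> R by rewrite subr_eq0 pnatr_eq1; lia.
rewrite /urn_sq_dev -[k.+1]addn1 natrD in k1 *; field.
by rewrite addrK j1 k0 k1 km.
Qed.

(* Bounds the expected sum of [|q - x_j|] over [j <= k] when [a] of the [k]
   remaining balls are red, provided that [|x_j - p| <= c j + e j * (x_j - p)^2]. *)
Definition urn_potential p q c e (k a : nat) : R :=
  \sum_(1 <= j < k.+1) (`|q - p| + c j + e j * urn_sq_dev p k j (a%:R / k%:R)).

(** The summand [j = k + 1] pays for the current deviation by the triangle inequality through [p];
    the other summands are preserved on average by [urn_sq_dev_step]. *)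
Lemma urn_potential_step p q c e (k a : nat) : (a <= k.+1)%N ->
  `|a%:R / k.+1%:R - p| <= c k.+1 + e k.+1 * (a%:R / k.+1%:R - p) ^+ 2 ->
  `|q - a%:R / k.+1%:R| + a%:R / k.+1%:R * urn_potential p q c e k a.-1 +
   (1 - a%:R / k.+1%:R) * urn_potential p q c e k a
  <= urn_potential p q c e k.+1 a.
Proof.
move=> ak dev; rewrite /urn_potential [leRHS]big_nat_recr //= -addrA addrC.
apply: lerD; last first.
  rewrite /urn_sq_dev subrr mulr0 mul0r addr0.
  apply: le_trans (ler_distD p _ _) _; rewrite -addrA lerD2l distrC.
  exact: dev.
rewrite !mulr_sumr -big_split /= le_eqVlt; apply/orP; left; apply/eqP.
apply: eq_big_nat => j /andP[j1 jk].
rewrite -urn_sq_dev_step ?j1 //.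
(* At [a = 0] the predecessor is truncated, but its weight is 0. *)
have [->|a0] := posnP a; first by rewrite !mul0r; ring.
have -> : a.-1%:R = a%:R - 1 :> R by rewrite -subn1 natrB.
ring.
Qed.

(** The sum telescopes: with [x] and [y] the roots of [n] and [n + 1], [2 (y - x)] exceeds [1 / y]
    by [(y - x) ^ 2 / y]. *)
Lemma sum_inv_sqrt_le (n : nat) :
  \sum_(1 <= j < n.+1) (Num.sqrt j%:R)^-1 <= 2 * Num.sqrt n%:R :> R.
Proof.
elim: n => [|n IHn]; first by rewrite big_geq // sqrtr0 mulr0.
rewrite big_nat_recr //=; apply: le_trans (lerD IHn (lexx _)) _.
set x := Num.sqrt n%:R; set y := Num.sqrt n.+1%:R.
have x0 : 0 <= x by apply: sqrtr_ge0.
have y0 : 0 < y by rewrite sqrtr_gt0.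
have x2 : x ^+ 2 = n%:R by rewrite sqr_sqrtr.
have y2 : y ^+ 2 = n%:R + 1 by rewrite sqr_sqrtr // natr1.
rewrite -subr_ge0.
have -> : 2 * y - (2 * x + y^-1) = (y - x) ^+ 2 / y.
  have {1}-> : y^-1 = (y ^+ 2 - x ^+ 2) / y by rewrite x2 y2 addrAC subrr add0r mul1r.
  by field; rewrite gt_eqF.
by rewrite divr_ge0 ?sqr_ge0 // ltW.
Qed.

(** The urn has a single colour, so its proportion never leaves [p]. *)
Lemma urn_potential_degenerate p q (n m : nat) : p = 0 \/ p = 1 -> (0 < n)%N ->
  n%:R * p = m%:R -> urn_potential p q (fun=> 0) (fun k => k%:R) n m = n%:R * `|q - p|.
Proof.
move=> p01 n0 np; have n0' : n%:R != 0 :> R by rewrite pnatr_eq0 -lt0n.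
have -> : urn_potential p q (fun=> 0) (fun k => k%:R) n m =
          \sum_(1 <= j < n.+1) `|q - p|.
  apply: eq_bigr => j _; have -> : m%:R / n%:R = p by rewrite -np; field.
  have pp : p * (1 - p) = 0 by case: p01 => ->; ring.
  by rewrite /urn_sq_dev pp !mul0r subrr expr0n /= !addr0 mulr0 addr0.
by rewrite sumr_const_nat subn1 mulr_natl.
Qed.

(* A proportion of [k + 1] balls distinct from [p] differs from it by at least
   [1 / (k + 1)]. *)
Lemma degenerate_deviation p (k a : nat) : p = 0 \/ p = 1 -> (a <= k.+1)%N ->
  `|a%:R / k.+1%:R - p| <= 0 + k.+1%:R * (a%:R / k.+1%:R - p) ^+ 2.
Proof.
move=> p01 ak; have k0 : 0 < k.+1%:R :> R by rewrite ltr0n.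
have [b E] : exists b : nat, `|a%:R / k.+1%:R - p| = b%:R / k.+1%:R.
  case: p01 => ->; first by exists a; rewrite subr0 ger0_norm ?divr_ge0.
  exists (k.+1 - a)%N; rewrite natrB // mulrBl divff ?gt_eqF // distrC ger0_norm //.
  by rewrite subr_ge0 ler_pdivrMr // mul1r ler_nat.
rewrite -[(_ - p) ^+ 2]real_normK ?num_real // E add0r.
have -> : k.+1%:R * (b%:R / k.+1%:R) ^+ 2 = (b ^ 2)%:R / k.+1%:R :> R.
  by rewrite natrX; field; rewrite nat1r gt_eqF.
by rewrite ler_wpM2r ?invr_ge0 ?ler0n // ler_nat; nia.
Qed.

(** By the inequality between arithmetic and geometric means, [|x - p|] is at most
    [s / 2 + (x - p) ^ 2 / (2 s)]. Here [s k] is the standard deviation of the proportion in [k]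
    draws with replacement, and the sum of the [s k] is bounded by [sum_inv_sqrt_le]. *)
Lemma urn_potential_interior p (n m : nat) : (0 < m < n)%N -> n%:R * p = m%:R ->
  exists c e : nat -> R,
    (forall (k : nat) x, (0 < k)%N -> `|x - p| <= c k + e k * (x - p) ^+ 2) /\
    forall q, urn_potential p q c e n m <=
      n%:R * `|q - p| + 2 * Num.sqrt (n%:R * (p * (1 - p))).
Proof.
move=> /andP[m0 mn] np.
have n0 : 0 < n%:R :> R by rewrite ltr0n; lia.
have m1 : 1 <= m%:R :> R by rewrite ler1n.
have mn1 : m%:R + 1 <= n%:R :> R by rewrite natr1 ler_nat.
have pE : p = m%:R / n%:R by rewrite -np; field; rewrite gt_eqF.
set v := p * (1 - p).
have v0 : 0 < v.
  have -> : v = m%:R * (n%:R - m%:R) / n%:R ^+ 2 by rewrite /v pE; field; rewrite gt_eqF.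
  by rewrite divr_gt0 ?exprn_gt0 // mulr_gt0 //; lra.
pose s k : R := Num.sqrt v / Num.sqrt k%:R.
have s0 k : (0 < k)%N -> 0 < s k by move=> k0; rewrite divr_gt0 // sqrtr_gt0 // ltr0n.
have s2 k : s k ^+ 2 = v / k%:R.
  by rewrite /s expr_div_n !sqr_sqrtr // ltW.
exists (fun k => s k / 2), (fun k => (2 * s k)^-1); split=> [k x k0|q].
  rewrite -[(x - p) ^+ 2]real_normK ?num_real // -subr_ge0.
  have sk := s0 _ k0.
  have -> : s k / 2 + (2 * s k)^-1 * `|x - p| ^+ 2 - `|x - p| =
            (`|x - p| - s k) ^+ 2 / (2 * s k) by field; rewrite gt_eqF.
  by rewrite divr_ge0 ?sqr_ge0 // mulr_ge0 // ltW.
have le_s j : (0 < j < n.+1)%N -> `|q - p| + s j / 2 +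
    (2 * s j)^-1 * urn_sq_dev p n j (m%:R / n%:R) <= `|q - p| + s j.
  move=> /andP[j0 jn]; rewrite -addrA lerD2l /urn_sq_dev -pE subrr expr0n /= add0r.
  have sj := s0 _ j0.
  have j1 : 1 <= j%:R :> R by rewrite ler1n.
  rewrite [leRHS](_ : s j = s j / 2 + (2 * s j)^-1 * (s j ^+ 2)); last first.
    by field; rewrite gt_eqF.
  rewrite lerD2l; apply: ler_wpM2l; first by rewrite invr_ge0 mulr_ge0 // ltW.
  rewrite s2 -/v.
  (* The last factor is the finite population correction, at most 1: sampling without replacement
     only lowers the variance. *)
  have -> : v * (n%:R - j%:R) / ((n%:R - 1) * j%:R) =
            v / j%:R * ((n%:R - j%:R) / (n%:R - 1)) by rewrite invfM; ring.
  apply: ler_piMr; first by rewrite divr_ge0 // ltW.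
  have jn' : j%:R <= n%:R :> R by rewrite ler_nat.
  by rewrite ler_pdivrMr; lra.
apply: le_trans (_ : \sum_(1 <= j < n.+1) (`|q - p| + s j) <= _).
  by apply: ler_sum_nat => j; apply: le_s.
rewrite big_split /= sumr_const_nat subn1 -[_ *+ _]mulr_natl. rewrite lerD2l -mulr_sumr.
have -> : 2 * Num.sqrt (n%:R * v) = Num.sqrt v * (2 * Num.sqrt n%:R).
  by rewrite sqrtrM ?ler0n //; ring.
rewrite ler_wpM2l ?sqrtr_ge0 //.
exact: sum_inv_sqrt_le.
Qed.

(* The constant 9 splits as [1 + 2 * 4]: replacing [q] by [p = m / n] costs
   [n |q - p|] on the left and at most doubles [binomE q] on the right. *)
Lemma urn_potential_exists (n m : nat) q : (m <= n)%N -> 0 <= q <= 1 ->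
  exists G : nat -> nat -> R,
    [/\ forall a, G 0%N a = 0,
        forall k a, (a <= k.+1)%N ->
          `|q - a%:R / k.+1%:R| + a%:R / k.+1%:R * G k a.-1 +
            (1 - a%:R / k.+1%:R) * G k a <= G k.+1 a
      & G n m <= 9 * binomE q Num.norm n (- m%:R)].
Proof.
move=> mn q01; have L0 := le_trans (normr_ge0 _) (binomE_norm_ge n (- m%:R) q01).
have [n_eq0|n0] := posnP n.
  exists (urn_potential 0 q (fun=> 0) (fun k => k%:R)); split=> [a|k a ak|].
  - by rewrite /urn_potential big_geq.
  - by apply: urn_potential_step => //; apply: degenerate_deviation => //; left.
  - by rewrite n_eq0 /urn_potential big_geq // mulr_ge0 // -n_eq0.
have n0' : 0 < n%:R :> R by rewrite ltr0n.
pose p : R := m%:R / n%:R.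
have np : n%:R * p = m%:R by rewrite /p; field; rewrite gt_eqF.
have dq : n%:R * `|q - p| <= binomE q Num.norm n (- m%:R).
  apply: le_trans (binomE_norm_ge n (- m%:R) q01).
  by rewrite -np -{1}(gtr0_norm n0') -normrM mulrBr addrC.
have [m_int|m_end] := boolP (0 < m < n)%N; last first.
  have p01 : p = 0 \/ p = 1.
    have [m0|m0] := posnP m; first by left; rewrite /p m0 mul0r.
    by right; rewrite /p (_ : m = n) ?divff ?gt_eqF //; lia.
  exists (urn_potential p q (fun=> 0) (fun k => k%:R)); split=> [a|k a ak|].
  - by rewrite /urn_potential big_geq.
  - by apply: urn_potential_step => //; apply: degenerate_deviation.
  - rewrite urn_potential_degenerate //; lra.
have p01 : 0 <= p <= 1.
  by rewrite /p divr_ge0 //= ler_pdivrMr // mul1r ler_nat.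
have [c [e [dev G_le]]] := urn_potential_interior m_int np.
exists (urn_potential p q c e); split=> [a|k a ak|].
- by rewrite /urn_potential big_geq.
- by apply: urn_potential_step => //; apply: dev.
have := binomE_norm_ge_sd m_int np.
have := binomE_norm_coupling n (- m%:R) p01 q01; rewrite distrC.
have := G_le q; lra.
Qed.

End UrnPotential.

(** * The matching process *)

Section Run.
Variables (R : realType) (Z : finType).

(* The expectation of [F] on the history reached from [h] after [k] more steps of
   the process with transition probabilities [q]. *)
Fixpoint run (q : seq Z -> Z -> R) (F : seq Z -> R) (k : nat) (h : seq Z) : R :=
  if k is k'.+1 then \sum_z q h z * run q F k' (rcons h z) else F h.

Lemma sum_ffun_recl (n : nat) (f : {ffun 'I_n.+1 -> Z} -> R) :
  \sum_z f z =
  \sum_z0 \sum_(z : {ffun 'I_n -> Z}) f [ffun i => oapp z z0 (unlift ord0 i)].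
Proof.
rewrite pair_bigA /=.
apply: (reindex (fun y : Z * {ffun 'I_n -> Z} => [ffun i => oapp y.2 y.1 (unlift ord0 i)])).
exists (fun z : {ffun 'I_n.+1 -> Z} => (z ord0, [ffun i => z (lift ord0 i)])).
  move=> [z0 z] _; rewrite ffunE unlift_none; congr pair; apply/ffunP => i.
  by rewrite !ffunE liftK.
move=> z _; apply/ffunP => i; rewrite ffunE /=.
by case: unliftP => [j ->|->] //=; rewrite ffunE.
Qed.

(** This turns sums over whole trajectories, as in the definitions of the expected costs, into a
    recursion on steps; the prefix [h] is there for the induction. *)
Lemma sum_prod_run (q : seq Z -> Z -> R) F n h :
  \sum_(z : {ffun 'I_n -> Z})
     (\prod_(t < n) q (h ++ [seq z u | u : 'I_n <- enum 'I_n & (u < t)%N]) (z t)) *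
     F (h ++ [seq z u | u : 'I_n <- enum 'I_n]) = run q F n h.
Proof.
elim: n h => [|n IHn] h /=.
  rewrite (big_pred1 (ffun0 (card_ord 0))) => [|z]; last first.
    by apply/esym/eqP/ffunP; case.
  by rewrite big_ord0 mul1r (size0nil (size_enum_ord 0)) cats0.
rewrite sum_ffun_recl; apply: eq_bigr => z0 _; rewrite -IHn mulr_sumr.
apply: eq_bigr => z _; rewrite big_ord_recl ffunE unlift_none /= -mulrA.
have E0 : [seq u : 'I_n.+1 <- enum 'I_n.+1 | (u < @ord0 n)%N] = [::].
  exact: filter_pred0.
rewrite E0 cats0; congr (_ * (_ * F _)).
  apply: eq_bigr => t _; rewrite ffunE liftK /=; congr q.
  rewrite enum_ordSl /= ffunE unlift_none filter_map -map_comp cat_rcons.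
  congr (_ ++ _ :: _);
  by apply: eq_map => u; rewrite /= ffunE liftK.
rewrite enum_ordSl /= ffunE unlift_none -map_comp cat_rcons.
by congr (_ ++ _ :: _); apply: eq_map => u; rewrite /= ffunE liftK.
Qed.

Lemma run_iid (p : Z -> R) (A : {set Z}) (f : R -> R) y k h : \sum_z p z = 1 ->
  run (fun _ => p) (fun h => f ((count [in A] h)%:R + y)) k h =
  binomE (\sum_(z in A) p z) f k ((count [in A] h)%:R + y).
Proof.
move=> p1; elim: k h => [|k IHk] h //=.
under eq_bigr do rewrite IHk -cats1 count_cat /= addn0.
rewrite (bigID [in A]) /=; congr (_ + _).
  rewrite mulr_suml; apply: eq_bigr => z zA; rewrite zA natrD.
  by rewrite addrAC.
have -> : 1 - \sum_(z in A) p z = \sum_(z | z \notin A) p z.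
  by rewrite -p1 (bigID [in A]) /= addrAC subrr add0r.
by rewrite mulr_suml; apply: eq_bigr => z /negPf zA; rewrite zA addn0.
Qed.

End Run.

(** * Fair kernels on the free servers *)

Section Instance.
Variables (R : realType) (I : instance R).
Local Notation n := (nserv I).
Local Notation X := (point I).

Definition free_servers (h : history I) : {set 'I_n} := [set j | j \notin [seq a.2 | a <- h]].

Definition servers_in (S : {set 'I_n}) (A : {set X}) : nat :=
  #|[set j in S | server j \in A]|.

(* [K x] is the law of the server given to a request at [x]; every free server
   is used with the same probability, at expected cost at most [W]. *)
Definition fair_kernel (W : R) (S : {set 'I_n}) (K : X -> 'I_n -> R) : Prop :=
  [/\ forall x, is_distr (K x),
      forall x j, j \notin S -> K x j = 0,
      forall j, j \in S -> \sum_x law x * K x j = #|S|%:R^-1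
    & \sum_x \sum_j law x * K x j * dist x (server j) <= W].

Lemma is_distr_uniform (T : finType) (S : {set T}) : S != set0 ->
  is_distr (fun j => if j \in S then #|S|%:R^-1 else 0 : R).
Proof.
move=> S0; split=> [j|]; first by case: ifP; rewrite ?invr_ge0.
rewrite -big_mkcond sumr_const -[LHS]mulr_natl divff //.
by rewrite pnatr_eq0 cards_eq0.
Qed.

(** The law of the requests is transported to the image of the uniform law on [S], then to the
    servers at zero cost; [K] is the resulting plan conditioned on the request. *)
Lemma exists_fair_kernel cuts (S : {set 'I_n}) : S != set0 ->
  cut_decomposition (@dist R I) setT cuts ->
  exists K, fair_kernel (cut_sum cuts (fun A : {set X} =>
    `|\sum_(x in A) law x - (servers_in S A)%:R / #|S|%:R|)) S K.
Proof.
move=> S0 [_ _ transp]; have [law0 law1] := law_distr I.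
pose nu j : R := if j \in S then #|S|%:R^-1 else 0.
have [nu0 nu1] : is_distr nu := is_distr_uniform S0.
pose nu' x := \sum_(j | server j == x) nu j.
have nu'A (P : pred X) : \sum_(x | P x) nu' x = \sum_(j | P (server j)) nu j.
  rewrite (partition_big (@server R I) P) //=; apply: eq_bigr => x Px.
  by apply: eq_bigl => j; case: eqP => [->|_]; rewrite ?Px ?andbF.
have T1 := transp (@law R I) nu' law0 (fun x => sumr_ge0 _ (fun j _ => nu0 j)).
have {}T1 := T1 (fun x xT => match negP xT (in_setT x) with end)
  (fun x xT => match negP xT (in_setT x) with end).
have {}T1 : transportable (@law R I) nu' (@dist R I) _ :=
  T1 (etrans law1 (esym (etrans (nu'A predT) nu1))).
have T2 := transportable_preimage (c := fun x j => dist x (server j)) nu0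
  (fun j => dist_refl (server j)).
have [pi [pi0 pi1 pi2 piC]] := transportable_trans T1 T2
  (fun i j k => dist_triangle i j (server k)).
have pi_law x j : law x = 0 -> pi x j = 0.
  move=> lx; have := pi1 x; rewrite lx => /eqP.
  by rewrite psumr_eq0 // => /allP /(_ j (mem_index_enum _)) /eqP.
have pi_S x j : j \notin S -> pi x j = 0.
  move=> jS; have := pi2 j; rewrite /nu (negPf jS) => /eqP.
  by rewrite psumr_eq0 // => /allP /(_ x (mem_index_enum _)) /eqP.
(* At points of probability 0 the conditional law is undefined, and the uniform one is used
   instead. *)
pose K x j := if law x == 0 then nu j else pi x j / law x.
have lawK x j : law x * K x j = pi x j.
  rewrite /K; have [lx|lx] := eqVneq (law x) 0; first by rewrite lx mul0r pi_law.
  by rewrite mulrC divfK.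
exists K; split=> [x|x j jS|j jS|].
- split=> [j|]; first by rewrite /K; case: ifP => // _; rewrite divr_ge0.
  rewrite /K; have [lx|lx] := eqVneq (law x) 0; first exact: nu1.
  by rewrite -mulr_suml pi1 divff.
- by rewrite /K; case: ifP => _; [rewrite /nu (negPf jS) | rewrite pi_S ?mul0r].
- by under eq_bigr do rewrite lawK; rewrite pi2 /nu jS.
under eq_bigr do under eq_bigr do rewrite lawK.
apply: le_trans piC _; rewrite addr0 le_eqVlt; apply/orP; left; apply/eqP.
apply: eq_bigr => c _; congr (_ * `|_ - _|).
rewrite nu'A /nu -big_mkcondr /= sumr_const -[LHS]mulr_natl; congr (_%:R * _).
by apply: eq_card => j; rewrite !inE andbC.
Qed.

Lemma card_free_servers (h : history I) : uniq [seq a.2 | a <- h] ->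
  (#|free_servers h| + size h = n)%N.
Proof.
move=> uh; have -> : free_servers h = ~: [set j in [seq a.2 | a <- h]].
  by apply/setP => j; rewrite !inE.
rewrite -(size_map snd h) -(card_uniqP uh).
have := cardsC [set j in [seq a.2 | a <- h]]; rewrite card_ord addnC; apply: etrans.
by congr (_ + _)%N; apply: eq_card => j; rewrite inE.
Qed.

Lemma free_servers_neq0 (h : history I) : (size h < n)%N -> free_servers h != set0.
Proof.
move=> hn; apply/set0Pn; apply/existsP; apply: contraTT hn.
rewrite negb_exists -leqNgt => /forallP all_used.
rewrite -(size_map snd h) -[X in (X <= _)%N]card_ord.
apply: leq_trans (card_size [seq a.2 | a <- h]); apply: subset_leq_card.
by apply/subsetP => j _; have := all_used j; rewrite inE negbK.
Qed.

(** Using a uniformly random free server is a draw from an urn whose red balls are the free servers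
    in [A]. *)
Lemma sum_servers_in_remove (S : {set 'I_n}) (A : {set X}) (g : nat -> R) :
  \sum_(j in S) g (servers_in (S :\ j) A) =
  (servers_in S A)%:R * g (servers_in S A).-1 +
  (#|S|%:R - (servers_in S A)%:R) * g (servers_in S A).
Proof.
rewrite (bigID (fun j => server j \in A)) /=; congr (_ + _).
  rewrite (eq_bigr (fun=> g (servers_in S A).-1)) => [|j /andP[jS jA]].
    rewrite sumr_const mulr_natl; congr (_ *+ _).
    by apply: eq_card => j; rewrite !inE.
  congr g; rewrite /servers_in (cardsD1 j [set j in S | server j \in A]) inE jS jA add1n /=.
  by apply: eq_card => i; rewrite !inE andbA.
rewrite (eq_bigr (fun=> g (servers_in S A))) => [|j /andP[jS jA]]; last first.
  congr g; apply: eq_card => i; rewrite !inE.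
  by case: eqP => [->|_] /=; rewrite ?(negPf jA) ?andbF.
rewrite sumr_const -[LHS]mulr_natl; congr (_ * _).
have -> : #|S| = (servers_in S A + #|[set j in S | server j \notin A]|)%N.
  rewrite -(cardsID [set j | server j \in A] S); congr (_ + _)%N; apply: eq_card => j;
    rewrite !inE //.
  by rewrite andbC.
rewrite natrD addrAC subrr add0r; congr _%:R.
by apply: eq_card => j; rewrite !inE.
Qed.

End Instance.

(** * Comparison of ALG and OPT over the cuts *)

Section Competitive.
Variables (R : realType) (I : instance R).
Local Notation n := (nserv I).
Local Notation X := (point I).

Definition step_prob (A : policy I) (h : history I) (z : X * 'I_n) : R :=
  law z.1 * serve A h z.1 z.2.

Definition history_cost (h : history I) : R := \sum_(z <- h) dist z.1 (server z.2).

Lemma expected_alg_run (A : policy I) :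
  expected_alg A = run (step_prob A) history_cost n [::].
Proof.
rewrite -sum_prod_run /expected_alg.
under eq_bigr do rewrite mulr_sumr.
rewrite pair_bigA /= (reindex (fun z : {ffun 'I_n -> X * 'I_n} =>
  ([ffun t => (z t).1] : {ffun 'I_n -> X}, [ffun t => (z t).2] : {ffun 'I_n -> 'I_n}))) /=.
  apply: eq_bigr => z _; rewrite mulrA -big_split /=; congr (_ * _).
    apply: eq_bigr => t _; rewrite /step_prob !ffunE; congr (_ * serve A _ _ _).
    by apply: eq_map => u; rewrite !ffunE -surjective_pairing.
  rewrite /history_cost big_map big_enum /=; apply: eq_bigr => t _.
  by rewrite !ffunE.
exists (fun y : {ffun 'I_n -> X} * {ffun 'I_n -> 'I_n} => [ffun t => (y.1 t, y.2 t)]).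
  by move=> z _; apply/ffunP => t; rewrite !ffunE -surjective_pairing.
by move=> [r m] _; congr pair; apply/ffunP => t; rewrite !ffunE.
Qed.

Variable cuts : seq (R * {set X}).
Hypothesis cutsP : cut_decomposition (@dist R I) setT cuts.

Let w0 c : c \in cuts -> 0 <= c.1. Proof. by case: cutsP => + _ _; apply. Qed.

Lemma cut_sum_le (f g : {set X} -> R) : (forall A, f A <= g A) ->
  cut_sum cuts f <= cut_sum cuts g.
Proof.
move=> fg; rewrite /cut_sum big_seq [leRHS]big_seq; apply: ler_sum => c cin.
by rewrite ler_wpM2l // w0.
Qed.

Lemma cut_sum_linear (J : finType) (P : pred J) (a : J -> R) (f : J -> {set X} -> R) :
  \sum_(j | P j) a j * cut_sum cuts (f j) =
  cut_sum cuts (fun A => \sum_(j | P j) a j * f j A).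
Proof.
rewrite /cut_sum; under eq_bigr do rewrite mulr_sumr.
rewrite exchange_big; apply: eq_bigr => c _; rewrite mulr_sumr.
by apply: eq_bigr => j _; rewrite mulrCA.
Qed.

Local Notation nserv_in A := (servers_in setT A).

(** Any perfect matching crosses a cut at least as often as the numbers of requests and servers on
    one side differ. *)
Lemma opt_cost_ge (r : {ffun 'I_n -> X}) :
  cut_sum cuts (fun A => `|(count [in A] [seq r t | t <- enum 'I_n])%:R + - (nserv_in A)%:R|)
  <= opt_cost r.
Proof.
rewrite /opt_cost; move: [arg min_(s < _) _]%O => s.
apply: le_trans (_ : \sum_t cut_sum cuts (fun A =>
   `|(r t \in A)%:R - (server (s t) \in A)%:R|) <= _); last first.
  by case: cutsP => _ cut_le _; apply: ler_sum => t _; apply: cut_le; rewrite inE.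
under eq_bigr do rewrite -[cut_sum _ _]mul1r.
rewrite cut_sum_linear; apply: cut_sum_le => A; under eq_bigr do rewrite mul1r.
apply: le_trans (ler_norm_sum _ _ _); rewrite sumrB le_eqVlt; apply/orP; left; apply/eqP.
congr (`|_ - _|).
  rewrite -sum1_count big_map big_enum_cond /= natr_sum big_mkcond.
  by apply: eq_bigr => t _; case: ifP.
rewrite -(reindex_inj (@perm_inj _ s) (P := xpredT) (F := fun t => (server t \in A)%:R)) /=.
rewrite /servers_in -sum1_card natr_sum big_mkcond; apply: eq_bigr => t _.
by rewrite inE in_setT /=; case: (server t \in A).
Qed.

Lemma expected_opt_ge :
  cut_sum cuts (fun A => binomE (\sum_(x in A) law x) Num.norm n (- (nserv_in A)%:R))
  <= expected_opt I.
Proof.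
have [law0 law1] := law_distr I.
apply: le_trans (_ : \sum_r request_prob r * _ <= _); last first.
  apply: ler_sum => r _; apply: ler_wpM2l (opt_cost_ge r); exact: prodr_ge0.
rewrite cut_sum_linear; apply: cut_sum_le => A.
have := run_iid A Num.norm (- (nserv_in A)%:R) n [::] law1.
by rewrite add0r => <-; rewrite -sum_prod_run.
Qed.

Variables (A : policy I).
Hypothesis A_fair : forall h, (size h < n)%N ->
  fair_kernel (cut_sum cuts (fun B : {set X} =>
    `|\sum_(x in B) law x - (servers_in (free_servers h) B)%:R / #|free_servers h|%:R|))
    (free_servers h) (serve A h).

Variable G : {set X} -> nat -> nat -> R.
Hypothesis G0 : forall B a, G B 0%N a = 0.
Hypothesis G_step : forall (B : {set X}) k a, (a <= k.+1)%N ->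
  `|\sum_(x in B) law x - a%:R / k.+1%:R| + a%:R / k.+1%:R * G B k a.-1 +
    (1 - a%:R / k.+1%:R) * G B k a <= G B k.+1 a.

(** Fairness makes the server used uniform once the request is averaged out, whatever the history.
    On each cut the free servers thus follow an urn, and [G_step] pays for the expected cost given
    by the kernel. *)
Lemma run_le k (h : history I) : uniq [seq a.2 | a <- h] -> (size h + k = n)%N ->
  run (step_prob A) history_cost k h <=
  history_cost h + cut_sum cuts (fun B => G B k (servers_in (free_servers h) B)).
Proof.
elim: k h => [|k IHk] h uh hk /=.
  rewrite /cut_sum big1 ?addr0 // => c _; by rewrite G0 mulr0.
have hn : (size h < n)%N by lia.
have [K_distr K_out K_fair K_cost] := A_fair hn.
have Sk : #|free_servers h| = k.+1.
  by have := card_free_servers uh; lia.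
set S := free_servers h in K_distr K_out K_fair K_cost Sk *.
have [law0 law1] := law_distr I.
pose g (j : 'I_n) := cut_sum cuts (fun B => G B k (servers_in (S :\ j) B)).
apply: le_trans (_ : \sum_z step_prob A h z *
   (history_cost h + dist z.1 (server z.2) + g z.2) <= _).
  apply: ler_sum => -[x j] _ /=; rewrite /step_prob /=.
  (* Used servers have weight 0, so the induction hypothesis is needed only for histories without
     repeated servers. *)
  have [jS|jS] := boolP (j \in S); last by rewrite K_out // mulr0 !mul0r.
  apply: ler_wpM2l; first by rewrite mulr_ge0 //; case: (K_distr x).
  have jh : j \notin [seq a.2 | a <- h] by move: jS; rewrite inE.
  have := IHk (rcons h (x, j)); rewrite map_rcons rcons_uniq jh uh size_rcons.
  move=> /(_ isT) /(_ ltac:(lia)) /le_trans; apply.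
  rewrite /history_cost -cats1 big_cat big_seq1 /= lerD2l /g.
  rewrite le_eqVlt; apply/orP; left; apply/eqP; apply: eq_bigr => c _.
  congr (_ * G _ _ (servers_in _ _)); apply/setP => i.
  by rewrite !inE map_cat mem_cat negb_or /= inE andbC.
have sum_step (f : X -> 'I_n -> R) :
    \sum_z step_prob A h z * f z.1 z.2 = \sum_x \sum_j law x * serve A h x j * f x j.
  by rewrite pair_bigA.
under eq_bigr do rewrite !mulrDr.
rewrite !big_split /= (sum_step (fun _ _ => history_cost h)).
rewrite (sum_step (fun x j => dist x (server j))) (sum_step (fun _ j => g j)).
have -> : \sum_x \sum_j law x * serve A h x j * history_cost h = history_cost h.
  under eq_bigr => x _.
    rewrite -mulr_suml -mulr_sumr; have [_ ->] := K_distr x; rewrite mulr1.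
    over.
  by rewrite -mulr_suml law1 mul1r.
rewrite -addrA lerD2l.
apply: le_trans (lerD K_cost (lexx _)) _.
rewrite exchange_big /=.
have -> : \sum_j \sum_x law x * serve A h x j * g j = \sum_(j in S) k.+1%:R^-1 * g j.
  rewrite [RHS]big_mkcond /=; apply: eq_bigr => j _; rewrite -mulr_suml.
  case: ifP => jS; first by rewrite K_fair // Sk.
  by rewrite big1 ?mul0r // => x _; rewrite K_out ?jS // mulr0.
rewrite cut_sum_linear -[X in X + _]mul1r -[X in _ + X]mul1r.
have -> : forall f1 f2, 1 * cut_sum cuts f1 + 1 * cut_sum cuts f2 =
   cut_sum cuts (fun B => f1 B + f2 B).
  by move=> f1 f2; rewrite !mul1r /cut_sum -big_split; apply: eq_bigr => c _; rewrite mulrDr.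
apply: cut_sum_le => B; rewrite -mulr_sumr sum_servers_in_remove Sk.
have aS : (servers_in S B <= k.+1)%N.
  by rewrite -Sk; apply: subset_leq_card; apply/subsetP => j; rewrite inE => /andP[].
apply: le_trans (G_step B aS); rewrite -addrA lerD2l.
rewrite le_eqVlt; apply/orP; left; apply/eqP; field.
by rewrite nat1r pnatr_eq0.
Qed.

End Competitive.

(** * Choice of the algorithm *)

Lemma exists_competitive_policy (R : realType) (I : instance R) :
  is_tree_metric (@dist R I) ->
  exists A : policy I, expected_alg A <= 9 * expected_opt I.
Proof.
move=> tree; have [law0 law1] := law_distr I.
have [x0 _] : exists x : point I, True.
  apply/boolp.not_existsP => nox.
  by move: law1; rewrite big1 => [/eqP|x]; [rewrite eq_sym oner_eq0 | case: (nox x)].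
have [cuts cutsP] := tree_cut_decomposition
  (@dist_refl R I) (@dist_sym R I) (@dist_triangle R I) x0 tree.
pose W (S : {set 'I_(nserv I)}) := cut_sum cuts (fun B : {set point I} =>
    `|\sum_(x in B) law x - (servers_in S B)%:R / #|S|%:R|).
(* The kernel depends on the history only through the set of free servers. The guard is needed since
   the empty set carries no probability law. *)
have /boolp.choice [K K_fair] S :
    exists K : point I -> 'I_(nserv I) -> R, S != set0 -> fair_kernel (W S) S K.
  have [->|S0] := eqVneq S set0; first by exists (fun _ _ => 0).
  by have [K ?] := exists_fair_kernel S0 cutsP; exists K.
have fair h : (size h < nserv I)%N ->
    fair_kernel (W (free_servers h)) (free_servers h) (K (free_servers h)).
  by move=> /free_servers_neq0; apply: K_fair.
have serve_distr h x : (size h < nserv I)%N -> is_distr (K (free_servers h) x).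
  by case/fair => + _ _ _; apply.
have serve_out h x j : (size h < nserv I)%N -> j \in [seq a.2 | a <- h] ->
    K (free_servers h) x j = 0.
  by case/fair => _ K_out _ _ jh; apply: K_out; rewrite inE negbK.
pose A := Policy serve_distr serve_out; exists A.
pose m (B : {set point I}) := servers_in setT B.
have q01 (B : {set point I}) : 0 <= \sum_(x in B) law x <= 1.
  rewrite sumr_ge0 //= -law1 [leRHS](bigID [in B]) /= lerDl.
  exact: sumr_ge0.
have m_le B : (m B <= nserv I)%N by rewrite -[leqRHS]card_ord max_card.
have /boolp.choice [G GP] B := urn_potential_exists (m_le B) (q01 B).
rewrite expected_alg_run.
apply: le_trans (run_le cutsP (A := A) fair (G := G) _ _ _ _) _ => //.
- by move=> B a; case: (GP B).
- by move=> B k a; case: (GP B) => _ + _; apply.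
rewrite /history_cost big_nil add0r.
apply: le_trans (ler_wpM2l _ (expected_opt_ge cutsP)) => //.
have -> : free_servers ([::] : history I) = setT by apply/setP => j; rewrite !inE.
rewrite cut_sumZ; apply: (cut_sum_le cutsP) => B.
by case: (GP B).
Qed.

Theorem theorem2 (R : realType) :
  exists alg : online_algorithm R,
    competitive_on (fun I : instance R => is_tree_metric (@dist R I)) 9 alg.
Proof.
have H (I : instance R) : exists A : policy I,
    is_tree_metric (@dist R I) -> expected_alg A <= 9 * expected_opt I.
  have [/exists_competitive_policy [A HA]|ntree] := boolp.pselect (is_tree_metric (@dist R I)).
    by exists A.
  (* An algorithm must supply a policy on every instance; off tree metrics a uniformly random free
     server will do. *)
  pose u (S : {set 'I_(nserv I)}) j : R := if j \in S then #|S|%:R^-1 else 0.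
  have u_distr h (x : point I) : (size h < nserv I)%N -> is_distr (u (free_servers h)).
    by move=> /free_servers_neq0; apply: is_distr_uniform.
  have u_out h (x : point I) j : (size h < nserv I)%N -> j \in [seq a.2 | a <- h] ->
      u (free_servers h) j = 0 by move=> _ jh; rewrite /u inE jh.
  by exists (Policy u_distr u_out).
by exists (fun I => sval (boolp.cid (H I))) => I; case: boolp.cid.
Qed.
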